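(* For mixed polynomials $f:\mathbb{C}^2\to\mathbb{C}$ with $f(0)=0$, none of the following ten implications is an equivalence: \begin{itemize} \item (convenient and ND) $\Rightarrow$ IND; \ (convenient and ND) $\Rightarrow$ (weakly isolated singularity at the origin); \ IND $\Rightarrow$ PND; \ IND $\Rightarrow$ (weakly isolated singularity at the origin); \ PND $\Rightarrow$ (weakly isolated singularity at the origin); \item (convenient and SND) $\Rightarrow$ SIND; \ (convenient and SND) $\Rightarrow$ (isolated singularity at the origin); \ SIND $\Rightarrow$ SPND; \ SIND $\Rightarrow$ (isolated singularity at the origin); \ SPND $\Rightarrow$ (isolated singularity at the origin). \end{itemize} That is, for each of these implications there is a mixed polynomial $f$ with $f(0)=0$ that has the property on the right-hand side but not the property on the left-hand side.
   Context: A mixed polynomial is a (not identically zero) finite sum $f(z,\bar z)=\sum_{\nu,\mu}c_{\nu,\mu}z^\nu\bar z^\mu$ with $z=(u,v)\in\mathbb{C}^2$, $\bar z=(\bar u,\bar v)$, $z^\nu=u^{\nu_1}v^{\nu_2}$, $\bar z^\mu=\bar u^{\mu_1}\bar v^{\mu_2}$. Its support is $\mathrm{supp}(f)=\{\nu+\mu: c_{\nu,\mu}\neq 0\}\subset\mathbb{N}^2$. $f_u,f_{\bar u},f_v,f_{\bar v}$ denote the (Wirtinger) partial derivatives. $V_f=f^{-1}(0)$. $f$ is $u$-convenient if $f(u,0)\not\equiv0$, $v$-convenient if $f(0,v)\not\equiv 0$, and convenient if it is both. Singular set: put $s_{1,f}=f_u\overline{f_{\bar v}}-\overline{f_{\bar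 u}}f_v$, $s_{2,f}=|f_u|^2-|f_{\bar u}|^2$, $s_{3,f}=|f_v|^2-|f_{\bar v}|^2$ (these are mixed polynomials). The set of critical (singular) points of $f$ is $\Sigma_f=\{s_{1,f}=s_{2,f}=s_{3,f}=0\}$; it is the set of points where the real Jacobian matrix of $f$ does not have maximal rank. The origin is a weakly isolated singularity if it has an open neighbourhood $U$ with $U\cap V_f\cap\Sigma_f=\{0\}$, and an isolated singularity if it has an open neighbourhood $U$ with $U\cap\Sigma_f=\{0\}$. Face functions: a positive weight vector is $P=(p_1,p_2)$ with $p_1,p_2$ positive integers. The radial degree of a monomial $c_{\nu,\mu}z^\nu\bar z^\mu$ is $p_1(\nu_1+\mu_1)+p_2(\nu_2+\mu_2)$; $d(P;f)$ is the minimal radial degree among the monomials of $f$, and the face function $f_P$ is the sum of the monomials of $f$ of radial degree $d(P;f)$ (for the zero polynomial, the $P$-part is $0$). The Newton boundary $\Gamma_f$ is the union of the compact faces (vertices and 1-dimensional faces, ''1-faces'') of the convex hull of $\bigcup_{\nu+\mu\in\mathrm{supp}(f)}\left(\nu+\mu+\mathbb{R}_{\ge0}^2\right)$. For a compact face $\Delta$, $f_\Delta=\sum_{\nu+\mu\in\Delta}c_{\nu,\mu}z^\nu\bar z^\mu$, and $f_\Gamma=\sum_{\nu+\mu\in\Gamma_f}c_{\nu,\mu}z^\nu\bar z^\mu$. Let $P_1,\dots,P_N$ be the weight vectors (one for each 1-face) such that $f_{P_i}$ is the face function of a compact 1-face, with $P_i=(p_{i,1},p_{i,2})$ and $k_i=p_{i,1}/p_{i,2}$,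 ordered so that $k_1>k_2>\dots>k_N$. A vertex of $\Gamma_f$ is called extreme if it bounds a unique 1-face, and non-extreme if it bounds two. ND (Newton non-degenerate): $V_{f_\Delta}\cap\Sigma_{f_\Delta}\cap(\mathbb{C}^* )^2=\emptyset$ for every compact face $\Delta$ (vertex or 1-face) of $\Gamma_f$. SND: $\Sigma_{f_\Delta}\cap(\mathbb{C}^* )^2=\emptyset$ for every compact face $\Delta$ of $\Gamma_f$. IND: (i) $f_{P_1}$ has no critical points in $V_{f_{P_1}}\cap(\mathbb{C}^2\setminus\{v=0\})$ and $f_{P_N}$ has no critical points in $V_{f_{P_N}}\cap(\mathbb{C}^2\setminus\{u=0\})$; (ii) for each 1-face and each non-extreme vertex $\Delta$, $f_\Delta$ has no critical points in $V_{f_\Delta}\cap(\mathbb{C}^* )^2$. SIND: (i) $f_{P_1}$ has no critical points in $\mathbb{C}^2\setminus\{v=0\}$ and $f_{P_N}$ has no critical points in $\mathbb{C}^2\setminus\{u=0\}$; (ii) for each 1-face and each non-extreme vertex $\Delta$, $f_\Delta$ has no critical points in $(\mathbb{C}^* )^2$. If $\Gamma_f$ is a single vertex, $f$ is called SIND if $f_\Gamma$ has no critical points in $\mathbb{C}^2\setminus\{(0,0)\}$, and IND if $f_\Gamma$ has no critical points in $V_{f_\Gamma}\cap(\mathbb{C}^2\setminus\{(0,0)\})$. PND: for every positive weight vector $P$: (i) the system $(s_{1,f}(0,v))_P=(s_{2,f}(0,v))_P=(s_{3,f}(0,v))_P=(f(0,v))_P=0$ has no solution in $(\mathbb{C}^*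 )^2$, and the system $(s_{1,f}(u,0))_P=(s_{2,f}(u,0))_P=(s_{3,f}(u,0))_P=(f(u,0))_P=0$ has no solution in $(\mathbb{C}^* )^2$; (ii) the system $(s_{1,f})_P=(s_{2,f})_P=(s_{3,f})_P=f_P=0$ has no solution in $(\mathbb{C}^* )^2$. SPND: for every positive weight vector $P$: (i) the system $(s_{1,f}(0,v))_P=(s_{2,f}(0,v))_P=(s_{3,f}(0,v))_P=0$ has no solution in $(\mathbb{C}^* )^2$, and the system $(s_{1,f}(u,0))_P=(s_{2,f}(u,0))_P=(s_{3,f}(u,0))_P=0$ has no solution in $(\mathbb{C}^* )^2$; (ii) the system $(s_{1,f})_P=(s_{2,f})_P=(s_{3,f})_P=0$ has no solution in $(\mathbb{C}^* )^2$. Here $h(0,v)$ and $h(u,0)$ denote the mixed polynomials obtained from $h$ by setting $u=\bar u=0$, respectively $v=\bar v=0$. *)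

(* Defs.v *)
From HB Require Import structures.
From mathcomp Require Import all_boot all_order all_algebra.
From mathcomp Require Import complex.
From mathcomp Require Import mpoly.
From mathcomp Require Import boolp classical_sets reals topology normedtype.
From mathcomp Require Import convex.

Set Implicit Arguments.
Unset Strict Implicit.
Unset Printing Implicit Defensive.

Import Order.TTheory GRing.Theory Num.Theory numFieldNormedType.Exports.

Local Open Scope classical_set_scope.
Local Open Scope ring_scope.

(* R[i] seen as a numClosedFieldType, which is how it receives its topology. *)
Definition Cplx (R : realType) : numClosedFieldType := R[i].

(* A mixed polynomial is a polynomial in the four indeterminates
   u, v, ubar, vbar, in this order. *)
Definition iu : 'I_4 := @Ordinal 4 0 isT.
Definition iv : 'I_4 := @Ordinal 4 1 isT.
Definition iub : 'I_4 := @Ordinal 4 2 isT.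
Definition ivb : 'I_4 := @Ordinal 4 3 isT.

Section MixedPolynomials.
Variable R : realType.
Local Notation C := (Cplx R).

Definition mixed := {mpoly C[4]}.

Implicit Types (f g : mixed) (z : C * C) (m : 'X_{1..4}) (P : nat * nat).
Implicit Types (D E : set (R * R)).

Definition mval f z : C := f.@[tnth [tuple z.1; z.2; z.1^*; z.2^*]].

Definition mconj f : mixed :=
  map_mpoly Num.conj f \mPo [tuple 'X_iub; 'X_ivb; 'X_iu; 'X_iv].

(* f(0,v) and f(u,0) *)
Definition at_u0 f : mixed := f \mPo [tuple 0; 'X_iv; 0; 'X_ivb].
Definition at_v0 f : mixed := f \mPo [tuple 'X_iu; 0; 'X_iub; 0].

Definition s1 f : mixed :=
  f^`M(iu) * mconj f^`M(ivb) - mconj f^`M(iub) * f^`M(iv).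
Definition s2 f : mixed :=
  f^`M(iu) * mconj f^`M(iu) - f^`M(iub) * mconj f^`M(iub).
Definition s3 f : mixed :=
  f^`M(iv) * mconj f^`M(iv) - f^`M(ivb) * mconj f^`M(ivb).

Definition sing_eqs f : seq mixed := [:: s1 f; s2 f; s3 f].

Definition zeros (s : seq mixed) : set (C * C) :=
  [set z | forall g, g \in s -> mval g z = 0].

Definition variety f : set (C * C) := zeros [:: f].
Definition Sigma f : set (C * C) := zeros (sing_eqs f).

Definition torus : set (C * C) := [set z | z.1 != 0 /\ z.2 != 0].

Definition weakly_isolated_singularity f : Prop :=
  exists U : set (C * C),
    [/\ open U, U (0, 0) & U `&` variety f `&` Sigma f = [set (0, 0)]].

Definition isolated_singularity f : Prop :=
  exists U : set (C * C),
    [/\ open U, U (0, 0) & U `&` Sigma f = [set (0, 0)]].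

Definition u_convenient f : Prop := exists u : C, mval f (u, 0) != 0.
Definition v_convenient f : Prop := exists v : C, mval f (0, v) != 0.
Definition convenient f : Prop := u_convenient f /\ v_convenient f.

(* The point nu + mu of N^2 attached to the monomial z^nu zbar^mu. *)
Definition expt m : nat * nat := (m iu + m iub, m iv + m ivb)%N.
Definition exptR m : R * R := ((expt m).1%:R, (expt m).2%:R).

Definition positive_weight P : Prop := (0 < P.1)%N /\ (0 < P.2)%N.

Definition radial_degree P m : nat :=
  (P.1 * (expt m).1 + P.2 * (expt m).2)%N.

Definition mpart (Q : pred 'X_{1..4}) f : mixed :=
  \sum_(m <- msupp f | Q m) f@_m *: 'X_[m].

(* f_P *)
Definition weight_part P f : mixed :=
  mpart (fun m => all (fun m' => (radial_degree P m <= radial_degree P m')%N)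
                      (msupp f)) f.

(* f_Delta *)
Definition set_part D f : mixed := mpart (fun m => `[< D (exptR m) >]) f.

Definition convex_hull (A : set (R * R)) : set (R * R) :=
  smallest [set B : set (R * R) | convex_set B] A.

Definition newton_polyhedron f : set (R * R) :=
  convex_hull (\bigcup_(m in [set m | m \in msupp f])
    [set x | (exptR m).1 <= x.1 /\ (exptR m).2 <= x.2]).

(* A face of a polyhedron is a nonempty set of minimizers of a linear form
   (the zero form giving the polyhedron itself). *)
Definition face (N F : set (R * R)) : Prop :=
  F !=set0 /\
  exists a : R * R,
    F = [set x | N x /\
           forall y, N y -> a.1 * x.1 + a.2 * x.2 <= a.1 * y.1 + a.2 * y.2].

Definition compact_face f D : Prop :=
  face (newton_polyhedron f) D /\ compact D.

Definition vertex f D : Prop :=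
  compact_face f D /\ exists x, D = [set x].

(* The Newton polyhedron is unbounded of dimension 2, so its compact faces
   with more than one point are exactly those of dimension 1. *)
Definition one_face f D : Prop :=
  compact_face f D /\ exists x y, [/\ D x, D y & x <> y].

Definition newton_boundary f : set (R * R) :=
  \bigcup_(D in [set D | compact_face f D]) D.

Definition non_extreme_vertex f D : Prop :=
  vertex f D /\
  exists E1 E2, [/\ one_face f E1, one_face f E2, E1 <> E2,
                    D `<=` E1 & D `<=` E2].

Definition single_vertex f : Prop := exists x, newton_boundary f = [set x].

(* All weights of a given 1-face are proportional, so that they have the same
   f_P and the same ratio k; hence no normalization of P is needed below. *)
Definition one_face_weight f P : Prop :=
  positive_weight P /\
  exists D, one_face f D /\ weight_part P f = set_part D f.

Definition weight_ratio P : rat := P.1%:R / P.2%:R.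

(* P_1 and P_N, for the ordering k_1 > ... > k_N. *)
Definition first_weight f P : Prop :=
  one_face_weight f P /\
  forall Q, one_face_weight f Q -> weight_ratio Q <= weight_ratio P.
Definition last_weight f P : Prop :=
  one_face_weight f P /\
  forall Q, one_face_weight f Q -> weight_ratio P <= weight_ratio Q.

(* In the next two definitions, B g is the set of points that are forbidden
   for a face function g: its critical points lying on V_g, or all of its
   critical points for the strong versions. *)
Definition newton_nondegenerate (B : mixed -> set (C * C)) f : Prop :=
  forall D, compact_face f D -> B (set_part D f) `&` torus = set0.

Definition inner_nondegenerate (B : mixed -> set (C * C)) f : Prop :=
  (single_vertex f ->
     B (set_part (newton_boundary f) f) `&` ~` [set (0, 0)] = set0) /\
  (~ single_vertex f ->
     [/\ forall P, first_weight f P ->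
           B (weight_part P f) `&` ~` [set z | z.2 = 0] = set0,
         forall P, last_weight f P ->
           B (weight_part P f) `&` ~` [set z | z.1 = 0] = set0
       & forall D, one_face f D \/ non_extreme_vertex f D ->
           B (set_part D f) `&` torus = set0]).

Definition ND : mixed -> Prop :=
  newton_nondegenerate (fun g => variety g `&` Sigma g).
Definition SND : mixed -> Prop := newton_nondegenerate Sigma.
Definition IND : mixed -> Prop :=
  inner_nondegenerate (fun g => variety g `&` Sigma g).
Definition SIND : mixed -> Prop := inner_nondegenerate Sigma.

Definition partially_nondegenerate (s : seq mixed) : Prop :=
  forall P, positive_weight P ->
    [/\ zeros [seq weight_part P (at_u0 g) | g <- s] `&` torus = set0,
        zeros [seq weight_part P (at_v0 g) | g <- s] `&` torus = set0
      & zeros [seq weight_part P g | g <- s] `&` torus = set0].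

Definition PND f : Prop := partially_nondegenerate (rcons (sing_eqs f) f).
Definition SPND f : Prop := partially_nondegenerate (sing_eqs f).

(* Some mixed polynomial vanishing at the origin satisfies B but not A. *)
Definition converse_fails (A B : mixed -> Prop) : Prop :=
  exists f, [/\ exists z, mval f z != 0, mval f (0, 0) = 0, B f & ~ A f].

End MixedPolynomials.

(* Main.v *)
Require Import Defs.
From mathcomp Require Import all_boot all_order all_algebra.
From mathcomp Require Import complex mpoly.
From mathcomp Require Import boolp classical_sets reals topology normedtype.
From mathcomp Require Import unstable interval_inference convex ring lra zify.

(** Three mixed polynomials refute all ten converses.

    - [node] = u v vanishes on both axes, so it is not convenient. Its
      gradient (v, u) vanishes only at the origin, and its Newton boundary is one
      vertex carrying the whole polynomial; so it is SIND and its singularity is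
      isolated.

    - [damped] = 2 Re u + 2 i (|u|^2 + |v|^2) Im u has the single vertex (1, 0),
      and the vertex part 2 Re u is real valued, hence critical everywhere: IND
      fails. The higher terms repair this. The real Jacobian determinant s2 in
      the variable u is 4 |u|^2 + 2 |u - ubar|^2 + 4 |v|^2, so the origin is the
      only critical point; and each of the two groups of terms in u and in v is
      bihomogeneous and positive on the torus, so that no weight P gives a P-part
      of s2 with a zero there, and SPND holds. In short, IND looks at face parts
      of f before differentiating, where the leading terms of s2 cancel, while
      PND looks at face parts of s2 itself.

    - [cusp] = (u + v)^2 + v^3 is holomorphic with an isolated critical point of
      type A_2, but in coordinates in which the tangent line u + v = 0 of the
      cusp is not an axis. For P = (1, 1) the P-parts of s2, s3 and f are
      multiples of u + v, and s1 vanishes, so all have the common zero (1, -1)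
      in the torus: PND fails.

    The strong properties imply the weak ones ([SIND_IND], [SPND_PND],
    [isolated_weakly_isolated]), hence it is enough that each example has the
    strong form of what it satisfies and lacks the weak form of what it
    violates. Two facts give access to the definitions: a polynomial with a
    least exponent e has Newton boundary {e} ([newton_boundary_least_exponent]),
    and the P-part of a polynomial is its lowest homogeneous summand
    ([weight_part_lowest]). *)

Set Implicit Arguments.
Unset Strict Implicit.
Unset Printing Implicit Defensive.

Import Order.TTheory GRing.Theory Num.Theory numFieldNormedType.Exports.

Local Open Scope classical_set_scope.
Local Open Scope ring_scope.

(** * Newton boundaries reduced to one vertex *)

Section SingleVertex.
Variable R : realType.
Implicit Types (f : mixed R) (e x : R * R) (A : set (R * R)).

Definition quadrant e : set (R * R) := [set x | e.1 <= x.1 /\ e.2 <= x.2].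

Lemma quadrant_convex e : convex_set (quadrant e).
Proof.
move=> x y l; rewrite !inE => -[x1 x2] [y1 y2].
have le_avg (t a b c : R) :
    0 <= t -> t <= 1 -> a <= b -> a <= c -> a <= t * b + (1 - t) * c.
  by move=> t0 t1 ab ac; nra.
by split; apply: le_avg.
Qed.

Lemma compact_bounded_coord A :
  compact A -> exists M : R, forall x, A x -> x.1 <= M /\ x.2 <= M.
Proof.
move=> /compact_bounded/pinfty_ex_gt0[M _ AM]; exists M => x /AM /= xM.
have : Num.max `|x.1| `|x.2| <= M by exact: xM.
rewrite ge_max => /andP[x1M x2M].
by split; apply: le_trans (ler_norm _) _.
Qed.

(** A linear form with a minimum on a quadrant has nonnegative coefficients; if
    one of them is zero, the minimum is reached along a whole ray, which is not
    compact. So both are positive, and the corner is the only minimizer. *)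
Lemma compact_face_quadrant e A :
  face (quadrant e) A /\ compact A <-> A = [set e].
Proof.
split=> [[[[x0 Ax0] [a defA]] cA]|->].
  have [[e1 e2] minx0] : quadrant e x0 /\
      forall y, quadrant e y -> a.1 * x0.1 + a.2 * x0.2 <= a.1 * y.1 + a.2 * y.2.
    by move: Ax0; rewrite defA.
  have a1 : 0 <= a.1.
    have := minx0 (x0.1 + 1, x0.2); rewrite /quadrant /= => H.
    have := H _; nra.
  have a2 : 0 <= a.2.
    have := minx0 (x0.1, x0.2 + 1); rewrite /quadrant /= => H.
    have := H _; nra.
  (* The corner together with the rays on which the form is constant. *)
  have face_ray t s : 0 <= t -> 0 <= s -> a.1 * t = 0 -> a.2 * s = 0 ->
      A (e.1 + t, e.2 + s).
    move=> t0 s0 at0 as0; rewrite defA.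
    split=> [|y [y1 y2]]; rewrite /quadrant /=.
      by split; lra.
    nra.
  have {}a1 : 0 < a.1.
    rewrite lt_neqAle a1 andbT; apply/eqP => a10.
    have [M AM] := compact_bounded_coord cA.
    have M0 : 0 <= Num.max 0 (M - e.1 + 1) by rewrite le_max lexx.
    have M1 : M - e.1 + 1 <= Num.max 0 (M - e.1 + 1) by rewrite le_max lexx orbT.
    have := AM _ (face_ray _ 0 M0 (lexx 0) _ _).
    rewrite -a10 mul0r mulr0 => /(_ erefl erefl) /=; lra.
  have {}a2 : 0 < a.2.
    rewrite lt_neqAle a2 andbT; apply/eqP => a20.
    have [M AM] := compact_bounded_coord cA.
    have M0 : 0 <= Num.max 0 (M - e.2 + 1) by rewrite le_max lexx.
    have M1 : M - e.2 + 1 <= Num.max 0 (M - e.2 + 1) by rewrite le_max lexx orbT.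
    have := AM _ (face_ray 0 _ (lexx 0) M0 _ _).
    rewrite -a20 mul0r mulr0 => /(_ erefl erefl) /=; lra.
  apply/seteqP; split=> [x|x ->]; last first.
    have := face_ray 0 0 (lexx 0) (lexx 0).
    rewrite !mulr0 !addr0 -surjective_pairing.
    exact.
  rewrite defA => -[[x1 x2]] /(_ e) /= /(_ (conj (lexx _) (lexx _))) le_e.
  rewrite [x]surjective_pairing [e]surjective_pairing.
  by congr pair; nra.
split; last exact: compact_set1.
split; first by exists e.
(* The corner is cut out by the linear form x.1 + x.2. *)
exists (1, 1); apply/seteqP; split=> [x ->|x] /=.
  by split=> [|y [y1 y2]]; [split | rewrite !mul1r lerD].
move=> [[x1 x2]] /(_ e (conj (lexx _) (lexx _))) le_e.
rewrite [x]surjective_pairing [e]surjective_pairing.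
by congr pair; lra.
Qed.

Lemma newton_polyhedron_least_exponent f (m0 : 'X_{1..4}) : m0 \in msupp f ->
  (forall m, m \in msupp f ->
     ((expt m0).1 <= (expt m).1)%N && ((expt m0).2 <= (expt m).2)%N) ->
  newton_polyhedron f = quadrant (exptR R m0).
Proof.
move=> m0f min_m0; apply/seteqP; split.
  apply: smallest_sub; first exact: quadrant_convex.
  move=> x [m /min_m0/andP[le1 le2]] [x1 x2].
  by split; rewrite /= (le_trans _ x1, le_trans _ x2) //= ler_nat.
by apply: sub_smallest => x x0; exists m0.
Qed.

Lemma newton_boundary_least_exponent f (m0 : 'X_{1..4}) : m0 \in msupp f ->
  (forall m, m \in msupp f ->
     ((expt m0).1 <= (expt m).1)%N && ((expt m0).2 <= (expt m).2)%N) ->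
  newton_boundary f = [set exptR R m0].
Proof.
move=> m0f min_m0; rewrite /newton_boundary /compact_face.
rewrite (newton_polyhedron_least_exponent m0f min_m0).
apply/seteqP; split=> [x [D /compact_face_quadrant->]//|x ->].
by exists [set exptR R m0] => //; apply/compact_face_quadrant.
Qed.

End SingleVertex.

(** * Parts of mixed polynomials *)

Section Parts.
Variable R : realType.
Implicit Types (f g h p q : mixed R) (P : nat * nat) (d : nat).
Implicit Types (m : 'X_{1..4}) (i : 'I_4).

Lemma mcoeff_mpart (Q : pred 'X_{1..4}) f m :
  (mpart Q f)@_m = if Q m then f@_m else 0.
Proof.
rewrite /mpart raddf_sum /=.
rewrite (eq_bigr (fun m' => f@_m' * (m' == m)%:R)); last first.
  by move=> m' _; rewrite mcoeffZ mcoeffX.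
have [mf|mf] := boolP (m \in msupp f); last first.
  rewrite (memN_msupp_eq0 mf) if_same big_seq_cond big1 // => m' /andP[m'f _].
  by case: eqP m'f mf => [->->//|]; rewrite mulr0.
rewrite -big_filter; case: ifP => Qm.
  rewrite (bigD1_seq m) ?mem_filter ?Qm ?filter_uniq ?msupp_uniq //= eqxx mulr1.
  by rewrite big1 ?addr0 // => m' /negPf ->; rewrite mulr0.
rewrite big_seq big1 // => m'; rewrite mem_filter.
by case: eqP => [->|]; rewrite ?Qm ?mulr0.
Qed.

Lemma mpart_summand (Q : pred 'X_{1..4}) g h :
  {in msupp g, forall m, Q m} -> {in msupp h, forall m, ~~ Q m} ->
  mpart Q (g + h) = g.
Proof.
move=> Qg Qh; apply/mpolyP => m; rewrite mcoeff_mpart mcoeffD.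
have [mg|/memN_msupp_eq0->] := boolP (m \in msupp g).
  rewrite Qg //; have [/Qh|/memN_msupp_eq0->] := boolP (m \in msupp h).
    by rewrite Qg.
  by rewrite addr0.
rewrite add0r; have [/Qh/negPf->//|/memN_msupp_eq0->] := boolP (m \in msupp h).
by rewrite if_same.
Qed.

Definition weight_homog P d p := {in msupp p, forall m, radial_degree P m = d}.
Definition weight_order_gt P d p :=
  {in msupp p, forall m, (d < radial_degree P m)%N}.

Lemma radial_degreeD P m1 m2 :
  radial_degree P (m1 + m2) = (radial_degree P m1 + radial_degree P m2)%N.
Proof. rewrite /radial_degree /expt /= !mnmDE; lia. Qed.

Lemma weight_homogD P d p q :
  weight_homog P d p -> weight_homog P d q -> weight_homog P d (p + q).
Proof.
by move=> hp hq m /msuppD_le; rewrite mem_cat => /orP[/hp|/hq].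
Qed.

Lemma weight_homogB P d p q :
  weight_homog P d p -> weight_homog P d q -> weight_homog P d (p - q).
Proof.
by move=> hp hq m /msuppB_le; rewrite mem_cat => /orP[/hp|/hq].
Qed.

Lemma weight_homogM P d1 d2 p q :
  weight_homog P d1 p -> weight_homog P d2 q ->
  weight_homog P (d1 + d2) (p * q).
Proof.
move=> hp hq m /msuppM_le /allpairsP[[m1 m2] /= [/hp <- /hq <- ->]].
exact: radial_degreeD.
Qed.

Lemma weight_homogMn P d p k : weight_homog P d p -> weight_homog P d (p *+ k).
Proof.
move=> hp; elim: k => [|k IHk]; last by rewrite mulrS; apply: weight_homogD.
by rewrite mulr0n => m; rewrite msupp0.
Qed.

Lemma weight_homog_nat P d p k :
  weight_homog P d p -> weight_homog P d (k%:R * p).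
Proof. by rewrite mulr_natl; apply: weight_homogMn. Qed.

Lemma weight_homogU P i :
  weight_homog P (nth 0%N [:: P.1; P.2; P.1; P.2] i) ('X_i : mixed R).
Proof.
move=> m; rewrite msuppX inE => /eqP ->.
rewrite /radial_degree /expt /= !mnm1E.
by case: i => -[|[|[|[|//]]]] i4 /=; lia.
Qed.

Lemma weight_homogU_total i : weight_homog (1, 1)%N 1 ('X_i : mixed R).
Proof.
by have := @weight_homogU (1, 1)%N i; case: i => -[|[|[|[|//]]]].
Qed.

Lemma weight_homog_gt P d d' p :
  weight_homog P d' p -> (d < d')%N -> weight_order_gt P d p.
Proof. by move=> hp lt m /hp ->. Qed.

Lemma weight_order_gtD P d p q :
  weight_order_gt P d p -> weight_order_gt P d q ->
  weight_order_gt P d (p + q).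
Proof.
by move=> hp hq m /msuppD_le; rewrite mem_cat => /orP[/hp|/hq].
Qed.

(** The minimal radial degree of g + h is d, because g is not zero and the
    monomials of h, having other degrees, cannot cancel those of g. *)
Lemma weight_part_lowest P d g h :
  weight_homog P d g -> weight_order_gt P d h -> g != 0 ->
  weight_part P (g + h) = g.
Proof.
move=> hg hh; rewrite -msupp_eq0.
case def_g : (msupp g) => [//|m0 s] _.
have m0g : m0 \in msupp g by rewrite def_g mem_head.
have m0gh : m0 \in msupp (g + h).
  rewrite mcoeff_msupp mcoeffD (memN_msupp_eq0 (p := h)) ?addr0 -?mcoeff_msupp //.
  by apply/negP => /hh; rewrite (hg _ m0g) ltnn.
apply: mpart_summand => m mgh.
  apply/allP => m' /msuppD_le; rewrite mem_cat (hg _ mgh) => /orP[/hg->//|/hh].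
  exact: ltnW.
by apply/negP => /allP/(_ _ m0gh); rewrite (hg _ m0g) leqNgt hh.
Qed.

Lemma weight_part_homog P d p : weight_homog P d p -> weight_part P p = p.
Proof.
move=> hp; have [->|p0] := eqVneq p 0.
  by rewrite /weight_part /mpart msupp0 big_nil.
rewrite -[in LHS](addr0 p); apply: (weight_part_lowest hp) => //.
by move=> m; rewrite msupp0.
Qed.

End Parts.

(** * Derivation, conjugation, evaluation and substitution *)

Section Calc.
Variable R : realType.
Implicit Types (p q : mixed R).

Lemma mderivU i j : ('X_j : mixed R)^`M(i) = (i == j)%:R.
Proof.
rewrite mderivX mnm1E eq_sym; case: eqP => [->|]; rewrite ?scale0r //.
rewrite (_ : (_ - _)%MM = 0%MM) ?mpolyX0 ?scale1r //.
by apply/mnmP => k; rewrite mnmBE subnn mnm0E.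
Qed.

Lemma mconjD p q : mconj (p + q) = mconj p + mconj q.
Proof. by rewrite /mconj !raddfD. Qed.
Lemma mconjN p : mconj (- p) = - mconj p.
Proof. by rewrite /mconj !raddfN. Qed.
Lemma mconjM p q : mconj (p * q) = mconj p * mconj q.
Proof. by rewrite /mconj !rmorphM. Qed.
Lemma mconj_nat n : mconj (n%:R : mixed R) = n%:R.
Proof. by rewrite /mconj !rmorph_nat. Qed.
Lemma mconjU i :
  mconj ('X_i : mixed R) = [:: 'X_iub; 'X_ivb; 'X_iu; 'X_iv]`_i.
Proof. by rewrite /mconj map_mpolyX comp_mpolyXU. Qed.

Lemma mvalD p q z : mval (p + q) z = mval p z + mval q z.
Proof. exact: mevalD. Qed.
Lemma mvalN p z : mval (- p) z = - mval p z.
Proof. exact: mevalN. Qed.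
Lemma mvalM p q z : mval (p * q) z = mval p z * mval q z.
Proof. exact: mevalM. Qed.
Lemma mval_nat n z : mval (n%:R : mixed R) z = n%:R.
Proof. by rewrite /mval rmorph_nat. Qed.
Lemma mval0 z : mval (0 : mixed R) z = 0.
Proof. exact: meval0. Qed.
Lemma mvalU i z : mval ('X_i : mixed R) z = [:: z.1; z.2; z.1^*; z.2^*]`_i.
Proof. by rewrite /mval mevalXU (tnth_nth 0). Qed.
Lemma mval_neq0 (p : mixed R) z : mval p z != 0 -> p != 0.
Proof. by apply: contra_neq => ->; apply: mval0. Qed.

Section Composition.
Variable s : 4.-tuple (mixed R).
Lemma mcompD p q : (p + q) \mPo s = (p \mPo s) + (q \mPo s).
Proof. exact: comp_mpolyD. Qed.
Lemma mcompN p : (- p) \mPo s = - (p \mPo s).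
Proof. exact: comp_mpolyN. Qed.
Lemma mcompM p q : (p * q) \mPo s = (p \mPo s) * (q \mPo s).
Proof. exact: rmorphM. Qed.
Lemma mcomp_nat n : (n%:R : mixed R) \mPo s = n%:R.
Proof. exact: rmorph_nat. Qed.
Lemma mcompU i : ('X_i : mixed R) \mPo s = s`_i.
Proof. exact: comp_mpolyXU. Qed.
End Composition.

End Calc.

Hint Rewrite @mderivD @mderivN @mderivM @mderivU : mixed.
Hint Rewrite @mconjD @mconjN @mconjM @mconj_nat @mconjU : mixed.
Hint Rewrite @mvalD @mvalN @mvalM @mval_nat @mval0 @mvalU : mixed.
Hint Rewrite @mcompD @mcompN @mcompM @mcomp_nat @mcompU : mixed.

Ltac mixed_simpl := autorewrite with mixed; rewrite /=.

(** * Implications between the conditions *)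

Section Implications.
Variable R : realType.
Implicit Types f : mixed R.

Lemma inner_nondegenerate_sub (B B' : mixed R -> set (Cplx R * Cplx R)) f :
  (forall g, B g `<=` B' g) ->
  inner_nondegenerate B' f -> inner_nondegenerate B f.
Proof.
move=> BB' [single many].
have sub0 g D : B' g `&` D = set0 -> B g `&` D = set0.
  by move=> B'0; apply/seteqP; split=> // z [/BB' Bz Dz]; rewrite -B'0.
split=> [/single/sub0//|/many[first last faces]].
by split=> [P /first|P /last|D /faces]; apply: sub0.
Qed.

Lemma SIND_IND f : SIND f -> IND f.
Proof. by apply: inner_nondegenerate_sub => g z []. Qed.

Lemma SPND_PND f : SPND f -> PND f.
Proof.
move=> spnd P /spnd[no_u no_v no_z].
have sub0 (s : seq (mixed R)) g D : zeros s `&` D = set0 ->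
    zeros (rcons s g) `&` D = set0.
  move=> s0; apply/seteqP; split=> // z [sz Dz]; rewrite -s0; split=> // h hs.
  by apply: sz; rewrite mem_rcons inE hs orbT.
by split; rewrite map_rcons; apply: sub0.
Qed.

Lemma variety0 f : mval f (0, 0) = 0 -> variety f (0, 0).
Proof. by move=> f0 g; rewrite inE => /eqP ->. Qed.

Lemma isolated_weakly_isolated f : mval f (0, 0) = 0 ->
  isolated_singularity f -> weakly_isolated_singularity f.
Proof.
move=> /variety0 f0 [U [oU U0 US]]; exists U; split=> //.
by rewrite setIAC US; apply/seteqP; split=> [z []|z ->].
Qed.

Lemma Sigma_isolated f : Sigma f = [set (0, 0)] -> isolated_singularity f.
Proof. by move=> S0; exists setT; split; [exact: openT| |rewrite setTI]. Qed.

Lemma zeros_cons (g : mixed R) s :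
  zeros (g :: s) = [set z | mval g z = 0] `&` zeros s.
Proof.
apply/seteqP; split=> [z gsz|z [gz sz] h].
  by split=> [|h hs]; apply: gsz; rewrite inE ?eqxx ?hs ?orbT.
by rewrite inE => /predU1P[->|/sz].
Qed.

Lemma zeros_nil z : zeros ([::] : seq (mixed R)) z.
Proof. by move=> g; rewrite in_nil. Qed.

Lemma zeros_consI (g : mixed R) s z :
  mval g z = 0 -> zeros s z -> zeros (g :: s) z.
Proof. by rewrite zeros_cons. Qed.

Lemma zeros3 (a b c : mixed R) z : zeros [:: a; b; c] z <->
  [/\ mval a z = 0, mval b z = 0 & mval c z = 0].
Proof.
rewrite !zeros_cons.
by split=> [[? [? []]]|[? ? ?]].
Qed.

Lemma SigmaP f z :
  Sigma f z <-> [/\ mval (s1 f) z = 0, mval (s2 f) z = 0 & mval (s3 f) z = 0].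
Proof. exact: zeros3. Qed.
End Implications.

Section Examples.
Variable R : realType.
Local Notation C := (Cplx R).
Local Notation u := ('X_iu : mixed R).
Local Notation v := ('X_iv : mixed R).
Local Notation ub := ('X_iub : mixed R).
Local Notation vb := ('X_ivb : mixed R).

(** * The polynomial u v *)

Definition node := u * v.

Lemma s1_node : s1 node = 0.
Proof. by rewrite /s1 /node; mixed_simpl; ring. Qed.
Lemma s2_node : s2 node = v * vb.
Proof. by rewrite /s2 /node; mixed_simpl; ring. Qed.
Lemma s3_node : s3 node = u * ub.
Proof. by rewrite /s3 /node; mixed_simpl; ring. Qed.

Lemma Sigma_node : Sigma node = [set (0, 0)].
Proof.
apply/seteqP; split=> [[z w]|_ ->]; last first.
  by apply/SigmaP; rewrite s1_node s2_node s3_node; mixed_simpl; rewrite !mul0r.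
move/SigmaP; rewrite s1_node s2_node s3_node; mixed_simpl => -[_].
by move=> /eqP + /eqP; rewrite !mul_conjC_eq0 => /eqP -> /eqP ->.
Qed.

(** The face function of the only vertex is the whole polynomial. *)
Lemma SIND_node : SIND node.
Proof.
have nodeX : node = 'X_[U_(iu) + U_(iv)] by rewrite /node mpolyXD.
have supp_node : msupp node = [:: (U_(iu) + U_(iv))%MM] by rewrite nodeX msuppX.
have boundary : newton_boundary node = [set exptR R (U_(iu) + U_(iv))].
  apply: newton_boundary_least_exponent; rewrite supp_node ?mem_head //.
  by move=> m; rewrite inE => /eqP ->; rewrite !leqnn.
split=> [_|[]]; last by eexists; exact: boundary.
rewrite boundary -[node]addr0 /set_part mpart_summand ?Sigma_node ?setICr //.
- by move=> m; rewrite supp_node inE => /eqP ->; apply/asboolP.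
- by move=> m; rewrite msupp0.
Qed.

Lemma not_convenient_node : ~ convenient node.
Proof. by move=> [_ [w]]; rewrite /node; mixed_simpl; rewrite mul0r eqxx. Qed.

Lemma node_nonzero : exists z, mval node z != 0.
Proof. by exists (1, 1); rewrite /node; mixed_simpl; rewrite mulr1 oner_eq0. Qed.
Lemma node_at_0 : mval node (0, 0) = 0.
Proof. by rewrite /node; mixed_simpl; rewrite mulr0. Qed.

(** * The polynomial 2 Re u + 2 i (|u|^2 + |v|^2) Im u *)

Definition damped := (u + ub) + ((u - ub) * (u * ub) + (u - ub) * (v * vb)).

(** The summands of s2 in u and in v, of bidegrees (2, 0) and (0, 2). *)
Definition damped_s2u := 4%:R * (u * ub) - 2%:R * ((u - ub) * (u - ub)).
Definition damped_s2v := 4%:R * (v * vb).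
Lemma s1_damped : s1 damped = 2%:R * (ub - u) * vb.
Proof. by rewrite /s1 /damped; mixed_simpl; ring. Qed.
Lemma s2_damped : s2 damped = damped_s2u + damped_s2v.
Proof.
by rewrite /s2 /damped /damped_s2u /damped_s2v; mixed_simpl; ring.
Qed.
Lemma s3_damped : s3 damped = 0.
Proof. by rewrite /s3 /damped; mixed_simpl; ring. Qed.

(** As u - ubar is purely imaginary, -(u - ubar)^2 is the square of its modulus. *)
Lemma mval_damped_s2u z :
  mval damped_s2u z = 4%:R * `|z.1| ^+ 2 + 2%:R * `|z.1 - z.1^*| ^+ 2.
Proof.
by rewrite !normCK rmorphB /= conjCK /damped_s2u; mixed_simpl; ring.
Qed.

Lemma mval_damped_s2v z : mval damped_s2v z = 4%:R * `|z.2| ^+ 2.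
Proof. by rewrite normCK /damped_s2v; mixed_simpl. Qed.

Lemma damped_s2u_ge0 z : 0 <= mval damped_s2u z.
Proof. by rewrite mval_damped_s2u addr_ge0 // mulr_ge0 // exprn_ge0. Qed.

Lemma damped_s2v_ge0 z : 0 <= mval damped_s2v z.
Proof. by rewrite mval_damped_s2v mulr_ge0 // exprn_ge0. Qed.

Lemma damped_s2u_eq0 z : (mval damped_s2u z == 0) = (z.1 == 0).
Proof.
rewrite mval_damped_s2u paddr_eq0 ?mulr_ge0 ?exprn_ge0 // !mulf_eq0 !pnatr_eq0 /=.
rewrite !orbb !normr_eq0.
by case: eqP => //= ->; rewrite conjC0 subrr eqxx.
Qed.

Lemma damped_s2v_eq0 z : (mval damped_s2v z == 0) = (z.2 == 0).
Proof. by rewrite mval_damped_s2v !mulf_eq0 pnatr_eq0 /= orbb normr_eq0. Qed.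

Lemma damped_s2_eq0 z :
  (mval (damped_s2u + damped_s2v) z == 0) = (z.1 == 0) && (z.2 == 0).
Proof.
rewrite mvalD paddr_eq0 ?damped_s2u_ge0 ?damped_s2v_ge0 //.
by rewrite damped_s2u_eq0 damped_s2v_eq0.
Qed.

Lemma weight_homog_damped_s2u P : weight_homog P (P.1 + P.1) damped_s2u.
Proof.
have hu : weight_homog P P.1 u := @weight_homogU R P iu.
have hub : weight_homog P P.1 ub := @weight_homogU R P iub.
apply: weight_homogB; apply: weight_homog_nat; apply: weight_homogM => //;
  exact: weight_homogB.
Qed.

Lemma weight_homog_damped_s2v P : weight_homog P (P.2 + P.2) damped_s2v.
Proof.
apply: weight_homog_nat.
exact: weight_homogM (@weight_homogU R P iv) (@weight_homogU R P ivb).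
Qed.

(** Depending on the order of the two weights, the P-part is one of the two
    summands or their sum, and each of these is positive on the torus. *)
Lemma weight_part_damped_s2 P z : torus z ->
  mval (weight_part P (damped_s2u + damped_s2v)) z != 0.
Proof.
move=> [z1 z2].
have au := weight_homog_damped_s2u P; have av := weight_homog_damped_s2v P.
have u0 : mval damped_s2u z != 0 by rewrite damped_s2u_eq0.
have v0 : mval damped_s2v z != 0 by rewrite damped_s2v_eq0.
case: (ltngtP P.1 P.2) => P12.
- rewrite (weight_part_lowest au) ?(mval_neq0 u0) //.
  by apply: weight_homog_gt av _; lia.
- rewrite addrC (weight_part_lowest av) ?(mval_neq0 v0) //.
  by apply: weight_homog_gt au _; lia.
- rewrite (weight_part_homog (d := P.1 + P.1)).
    by rewrite damped_s2_eq0 (negPf z1).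
  by apply: weight_homogD => //; rewrite P12.
Qed.

Lemma at_u0_damped_s2 : at_u0 (damped_s2u + damped_s2v) = damped_s2v.
Proof. by rewrite /at_u0 /damped_s2u /damped_s2v; mixed_simpl; ring. Qed.
Lemma at_v0_damped_s2 : at_v0 (damped_s2u + damped_s2v) = damped_s2u.
Proof. by rewrite /at_v0 /damped_s2u /damped_s2v; mixed_simpl; ring. Qed.

Lemma SPND_damped : SPND damped.
Proof.
move=> P _; split; apply/seteqP; split=> // z [/zeros3[_ + _] tz] /=;
  rewrite s2_damped.
- rewrite at_u0_damped_s2.
  rewrite (weight_part_homog (weight_homog_damped_s2v P)) => /eqP.
  by rewrite damped_s2v_eq0 (negPf tz.2).
- rewrite at_v0_damped_s2.
  rewrite (weight_part_homog (weight_homog_damped_s2u P)) => /eqP.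
  by rewrite damped_s2u_eq0 (negPf tz.1).
- by move=> z0; have := weight_part_damped_s2 P tz; rewrite z0 eqxx.
Qed.

Lemma Sigma_damped : Sigma damped = [set (0, 0)].
Proof.
apply/seteqP; split=> [[z w] /SigmaP[_ + _]|_ ->].
  rewrite s2_damped => /eqP; rewrite damped_s2_eq0.
  by move=> /andP[/eqP/= -> /eqP/= ->].
apply/SigmaP; rewrite s1_damped s3_damped s2_damped mval0; split=> //.
  by mixed_simpl; rewrite conjC0 mulr0.
by apply/eqP; rewrite damped_s2_eq0 !eqxx.
Qed.

(** Each monomial contains u or ubar, which makes (1, 0) the least exponent. *)
Lemma weight_order_gt_damped : weight_order_gt (1, 0)%N 0 damped.
Proof.
have hu : weight_homog (1, 0)%N 1 u := @weight_homogU R (1, 0)%N iu.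
have hub : weight_homog (1, 0)%N 1 ub := @weight_homogU R (1, 0)%N iub.
have hv : weight_homog (1, 0)%N 0 v := @weight_homogU R (1, 0)%N iv.
have hvb : weight_homog (1, 0)%N 0 vb := @weight_homogU R (1, 0)%N ivb.
have h1 := weight_homog_gt (d:=0) (weight_homogD hu hub) isT.
have hB := weight_homogB hu hub.
have h2 := weight_homog_gt (d:=0) (weight_homogM hB (weight_homogM hu hub)) isT.
have h3 := weight_homog_gt (d:=0) (weight_homogM hB (weight_homogM hv hvb)) isT.
exact: weight_order_gtD h1 (weight_order_gtD h2 h3).
Qed.

Lemma weight_order_gt_damped_tail :
  weight_order_gt (1, 1)%N 1 ((u - ub) * (u * ub) + (u - ub) * (v * vb)).
Proof.
have h i := @weight_homogU_total R i.
apply: (@weight_homog_gt _ _ _ 3) => //.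
have hB := weight_homogB (h iu) (h iub).
exact: weight_homogD (weight_homogM hB (weight_homogM (h iu) (h iub)))
                     (weight_homogM hB (weight_homogM (h iv) (h ivb))).
Qed.

Lemma expt_u_ub m : m \in msupp (u + ub) -> expt m = (1, 0)%N.
Proof.
move=> /msuppD_le; rewrite mem_cat !msuppX !inE.
by case/orP=> /eqP->; rewrite /expt !mnm1E.
Qed.

(** The tail has total degree 3, so it cannot cancel the monomial u. *)
Lemma msupp_damped : U_(iu)%MM \in msupp damped.
Proof.
rewrite mcoeff_msupp 2!mcoeffD !mcoeffX eqxx.
rewrite [X in _ + X](memN_msupp_eq0 (p := _ + _)) ?addr0; last first.
  apply/negP => /weight_order_gt_damped_tail.
  by rewrite /radial_degree /expt !mnm1E.
suff -> : (U_(iub)%MM == U_(iu)%MM :> 'X_{1..4}) = false.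
  by rewrite addr0 oner_eq0.
by apply/negP => /eqP/mnmP/(_ iu); rewrite !mnm1E.
Qed.

Lemma newton_boundary_damped : newton_boundary damped = [set exptR R U_(iu)].
Proof.
apply: newton_boundary_least_exponent => [|m mf]; first exact: msupp_damped.
have := weight_order_gt_damped mf; rewrite /radial_degree /expt /= !mnm1E /=; lia.
Qed.

Lemma single_vertex_damped : single_vertex damped.
Proof. by exists (exptR R U_(iu)); exact: newton_boundary_damped. Qed.

Lemma set_part_damped : set_part (newton_boundary damped) damped = u + ub.
Proof.
rewrite newton_boundary_damped; apply: mpart_summand => m.
  move=> /expt_u_ub em; apply/asboolP.
  by rewrite /= /exptR em /expt !mnm1E.
move=> /weight_order_gt_damped_tail; apply: contraL => /asboolP [].
rewrite /radial_degree /expt /= !mnm1E /= => /eqP + /eqP.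
by rewrite !eqr_nat => /eqP -> /eqP ->.
Qed.

(** The vertex part u + ubar is real valued, hence critical everywhere; it
    vanishes on the axis u = 0. *)
Lemma not_IND_damped : ~ IND damped.
Proof.
move=> [/(_ single_vertex_damped) + _]; rewrite set_part_damped.
apply/eqP/set0P; exists (0, 1); split; last by move=> [] /eqP; rewrite oner_eq0.
split.
  by move=> g; rewrite inE => /eqP ->; mixed_simpl; rewrite conjC0 addr0.
have [s1_0 s2_0 s3_0] :
    [/\ s1 (u + ub) = 0, s2 (u + ub) = 0 & s3 (u + ub) = 0].
  by rewrite /s1 /s2 /s3; mixed_simpl; split; ring.
by apply/SigmaP; rewrite s1_0 s2_0 s3_0 mval0.
Qed.

Lemma damped_nonzero : exists z, mval damped z != 0.
Proof.
exists (1, 0); rewrite /damped; mixed_simpl.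
by rewrite conjC1 conjC0 subrr !mul0r !addr0 -(natrD _ 1 1) pnatr_eq0.
Qed.
Lemma damped_at_0 : mval damped (0, 0) = 0.
Proof. by rewrite /damped; mixed_simpl; rewrite conjC0; ring. Qed.

(** * The polynomial (u + v)^2 + v^3 *)

Definition cusp := (u + v) * (u + v) + v * (v * v).
Lemma s1_cusp : s1 cusp = 0.
Proof. by rewrite /s1 /cusp; mixed_simpl; ring. Qed.
Lemma s2_cusp : s2 cusp = 4%:R * ((u + v) * (ub + vb)).
Proof. by rewrite /s2 /cusp; mixed_simpl; ring. Qed.
Lemma s3_cusp : s3 cusp = 4%:R * ((u + v) * (ub + vb)) +
  (6%:R * ((u + v) * (vb * vb)) + 6%:R * ((v * v) * (ub + vb)) +
   9%:R * ((v * v) * (vb * vb))).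
Proof. by rewrite /s3 /cusp; mixed_simpl; ring. Qed.

(** A zero of s2 satisfies u + v = 0, and then s3 reduces to 9 |v|^4. *)
Lemma Sigma_cusp : Sigma cusp = [set (0, 0)].
Proof.
apply/seteqP; split=> [[z w] /SigmaP[_]|_ ->]; last first.
  apply/SigmaP; rewrite s1_cusp s2_cusp s3_cusp; mixed_simpl.
  by rewrite conjC0; split; ring.
rewrite s2_cusp s3_cusp; mixed_simpl; rewrite -rmorphD /= => /eqP.
rewrite mulf_eq0 pnatr_eq0 /= mul_conjC_eq0 => /eqP zw0.
rewrite zw0 conjC0 !(mul0r, mulr0) !add0r => /eqP.
rewrite !mulf_eq0 pnatr_eq0 /= conjC_eq0 !orbb => /eqP w0.
by move: zw0; rewrite w0 addr0 => ->.
Qed.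

(** The quadratic part of s2 and s3 is 4 |u + v|^2, that of f is (u + v)^2. *)
Lemma not_PND_cusp : ~ PND cusp.
Proof.
have h i := @weight_homogU_total R i.
have huv := weight_homogD (h iu) (h iv).
have huvb := weight_homogD (h iub) (h ivb).
have hvv := weight_homogM (h iv) (h iv).
have hvvb := weight_homogM (h ivb) (h ivb).
have hL : weight_homog (1, 1)%N 2 (4%:R * ((u + v) * (ub + vb))).
  exact: weight_homog_nat (weight_homogM huv huvb).
have on_line : 1 + -1 = 0 :> C by rewrite subrr.
move=> /(_ (1, 1)%N (conj isT isT)) [_ _].
apply/eqP/set0P; exists (1, -1).
split; last by split; rewrite /= ?oppr_eq0 oner_eq0.
rewrite /sing_eqs /= s1_cusp s2_cusp s3_cusp.
have L_z : mval (4%:R * ((u + v) * (ub + vb))) (1, -1) = 0.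
  by mixed_simpl; rewrite on_line mul0r mulr0.
have s1_z : mval (weight_part (1, 1)%N (0 : mixed R)) (1, -1) = 0.
  by rewrite (@weight_part_homog _ _ 0) ?mval0 // => m; rewrite msupp0.
have s2_z :
    mval (weight_part (1, 1)%N (4%:R * ((u + v) * (ub + vb)))) (1, -1) = 0.
  by rewrite (weight_part_homog hL).
have s3_z : mval (weight_part (1, 1)%N (s3 cusp)) (1, -1) = 0.
  rewrite s3_cusp (weight_part_lowest hL) //; last first.
    apply: (@mval_neq0 _ _ (1, 0)); mixed_simpl.
    by rewrite conjC0 conjC1 !addr0 !mulr1 pnatr_eq0.
  have gt2 d (p : mixed R) k : weight_homog (1, 1)%N d.+3 p ->
      weight_order_gt (1, 1)%N 2 (k%:R * p).
    by move=> hp; apply: weight_homog_gt (weight_homog_nat hp) _.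
  have h1 := gt2 _ _ 6 (weight_homogM huv hvvb).
  have h2 := gt2 _ _ 6 (weight_homogM hvv huvb).
  have h3 := gt2 _ _ 9 (weight_homogM hvv hvvb).
  exact: weight_order_gtD (weight_order_gtD h1 h2) h3.
have cusp_z : mval (weight_part (1, 1)%N cusp) (1, -1) = 0.
  rewrite (weight_part_lowest (weight_homogM huv huv)).
  - by mixed_simpl; rewrite on_line mul0r.
  - exact: weight_homog_gt (weight_homogM (h iv) hvv) _.
  - apply: (@mval_neq0 _ _ (1, 0)); mixed_simpl.
    by rewrite addr0 mulr1 oner_eq0.
rewrite s3_cusp in s3_z.
exact: zeros_consI s1_z (zeros_consI s2_z (zeros_consI s3_z (zeros_consI cusp_z
  (@zeros_nil _ _)))).
Qed.

Lemma cusp_nonzero : exists z, mval cusp z != 0.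
Proof.
exists (1, 0); rewrite /cusp; mixed_simpl.
by rewrite !addr0 mul0r addr0 mulr1 oner_eq0.
Qed.
Lemma cusp_at_0 : mval cusp (0, 0) = 0.
Proof. by rewrite /cusp; mixed_simpl; ring. Qed.
End Examples.

(** * The ten converses *)

Theorem theorem1p3 (R : realType) :
  [/\ @converse_fails R (fun f => convenient f /\ ND f) (@IND R),
      @converse_fails R (fun f => convenient f /\ ND f)
                        (@weakly_isolated_singularity R),
      @converse_fails R (@IND R) (@PND R),
      @converse_fails R (@IND R) (@weakly_isolated_singularity R)
    & @converse_fails R (@PND R) (@weakly_isolated_singularity R)]
  /\
  [/\ @converse_fails R (fun f => convenient f /\ SND f) (@SIND R),
      @converse_fails R (fun f => convenient f /\ SND f)
                        (@isolated_singularity R),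
      @converse_fails R (@SIND R) (@SPND R),
      @converse_fails R (@SIND R) (@isolated_singularity R)
    & @converse_fails R (@SPND R) (@isolated_singularity R)].
Proof.
have node_isolated := Sigma_isolated (Sigma_node R).
have damped_isolated := Sigma_isolated (Sigma_damped R).
have cusp_isolated := Sigma_isolated (Sigma_cusp R).
have weak := isolated_weakly_isolated.
have [[? ?] ?] := (node_nonzero R, node_at_0 R, @not_convenient_node R).
have [[? ?] ?] := (damped_nonzero R, damped_at_0 R, @not_IND_damped R).
have [[? ?] ?] := (cusp_nonzero R, cusp_at_0 R, @not_PND_cusp R).
have ? := SIND_node R; have ? := SPND_damped R.
split; split.
- by exists (node R); split; [| |exact: SIND_IND|case].
- by exists (node R); split; [| |exact: weak|case].
- by exists (damped R); split; [| |exact: SPND_PND|].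
- by exists (damped R); split; [| |exact: weak|].
- by exists (cusp R); split; [| |exact: weak|].
- by exists (node R); split; [| | |case].
- by exists (node R); split; [| | |case].
- by exists (damped R); split; [| | |move/SIND_IND].
- by exists (damped R); split; [| | |move/SIND_IND].
- by exists (cusp R); split; [| | |move/SPND_PND].
Qed.
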